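(* Let $k$ be an even integer with $k\ge 4$ and let $d=\frac{1}{2}(3k+4)$. Then the maximum length of a symmetric $(d,k)$ circuit code is $4k+6$. Furthermore, there is a unique, up to isomorphism, symmetric $(d,k)$ circuit code of length $4k+6$; that is, such a code exists, and any two symmetric $(d,k)$ circuit codes of length $4k+6$ are isomorphic.
   Context: $I(d)$ denotes the graph of the $d$-dimensional hypercube: its vertices may be identified with the binary vectors of length $d$, two vertices being adjacent if and only if their vectors differ in exactly one position. A cycle $C$ of $I(d)$ is a $(d,k)$ circuit code (a $d$-dimensional circuit code of spread $k$) if $d_{I(d)}(x,y)\ge \min\{d_C(x,y),k\}$ for all vertices $x,y\in C$, where $d_{I(d)}(x,y)$ and $d_C(x,y)$ denote the minimum path length between $x$ and $y$ in $I(d)$ and in $C$, respectively. The length of $C$ is its number $N=|C|$ of vertices (equivalently, of edges). Transition sequence: write $C=(x_1,x_2,\ldots,x_N)$ as a cyclic sequence of consecutive vertices, with $x_{N+1}=x_1$, and identify the vertices of $I(d)$ with binary vectors of length $d$ (adjacent vertices corresponding exactly to vectors differing in a single position) so that $x_1$ is mapped to $\vec{0}$. The transition sequence of $C$ is $T(C)=(\tau_1,\tau_2,\ldots,\tau_N)$, where $\tau_i\in[d]=\{1,\ldots,d\}$ is the single position in which the vectors of $x_i$ and $x_{i+1}$ differ. The transition sequence (and the circuit code $C$) is symmetric if $\tau_i=\tau_{N/2+i}$ for $i=1,\ldots,\frac{N}{2}$ (the length $N$ of a cycle of $I(d)$ is always even). Two $(d,k)$ circuit codes $C$ and $C'$ are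 isomorphic if $T(C)$ can be transformed into $T(C')$ by a cyclic shift of the sequence and a permutation of $[d]$ applied to its values (reflecting that $C$ and $C'$ are identical up to the selection of the starting vertex and some symmetry of $I(d)$). *)

(* Defs.v *)
From mathcomp Require Import all_boot perm.

Set Implicit Arguments.
Unset Strict Implicit.
Unset Printing Implicit Defensive.

(* Minimum length of an e-walk from x to y.  A shortest walk has fewer than
   #|T| edges; the value is #|T| when y is not reachable from x. *)
Definition gdist (T : finType) (e : rel T) (x y : T) : nat :=
  \big[minn/#|T|]_(n < #|T| |
     [exists p : n.-tuple T, path e x p && (last x p == y)]) n.

Notation cube d := {ffun 'I_d -> bool}.

Definition cube_adj (d : nat) : rel (cube d) :=
  fun x y => #|[set i | x i != y i]| == 1.

(* A cycle of a graph is listed as c = [:: x_1; ...; x_N], starting anywhere and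
   running in either direction; a graph cycle has at least 3 vertices. *)
Definition graph_cycle (T : finType) (e : rel T) (c : seq T) : bool :=
  [&& 2 < size c, cycle e c & uniq c].

(* Adjacency in the cycle itself, viewed as a subgraph (chords excluded).
   Membership is required because next c x = x outside c. *)
Definition cycle_adj (T : finType) (c : seq T) : rel T :=
  fun x y => [&& x \in c, y \in c & (next c x == y) || (next c y == x)].

Definition circuit_code (d k : nat) (c : seq (cube d)) : Prop :=
  graph_cycle (@cube_adj d) c /\
  {in c &, forall x y : cube d,
     minn (gdist (cycle_adj c) x y) k <= gdist (@cube_adj d) x y}.

(* Consecutive vertices of a cycle of the cube differ in exactly one position, so
   pmap drops nothing and the i-th term is the position changed between x_i and
   x_(i+1), with x_(N+1) = x_1.  The normalisation x_1 = 0 is immaterial: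
   translating all the vertices by x_1 leaves this sequence unchanged. *)
Definition transitions (d : nat) (c : seq (cube d)) : seq 'I_d :=
  pmap (fun xy : cube d * cube d => [pick i | xy.1 i != xy.2 i])
       (zip c (rot 1 c)).

(* onth is used only to avoid a default value: both indices are in range. *)
Definition symmetric_seq (T : Type) (t : seq T) : Prop :=
  forall i, i < (size t)./2 -> onth t i = onth t ((size t)./2 + i).

Definition symmetric_code (d k : nat) (c : seq (cube d)) : Prop :=
  circuit_code k c /\ symmetric_seq (transitions c).

Definition isomorphic_codes (d : nat) (c c' : seq (cube d)) : Prop :=
  exists (n : nat) (s : {perm 'I_d}),
    transitions c' = [seq s i | i <- rot n (transitions c)].

(* Main.v *)
Require Import Defs.
From mathcomp Require Import all_boot perm zify.

Set Implicit Arguments.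
Unset Strict Implicit.
Unset Printing Implicit Defensive.

(* Let k = 2m, d = 3m + 2 and let the code have length 2n.  By symmetry, x_(i+n) is
   x_i with a fixed set D of coordinates flipped.  Deleting a D-transition from
   a window of length n gives #|D| > k, and equal transitions are more than k
   apart, so for n < 3(k+1) every letter occurs at most twice in a half period,
   letters of D exactly once; hence n + #|D| <= 2d and n <= 2k + 3.  For
   n >= 3(k+1) one has d(x,y) + d(y,x+D) = #|D| + 2v(x,y), with v the distance
   outside D; applied to the pairs of three points about k apart, together with
   the bound 2(d - #|D|) on the sum of their three v's, this contradicts
   #|D| > k (by a parity argument when m = 2).
   When n = 2k + 3 all these bounds are tight: there are 2m + 1 letters in D, no
   two of them adjacent, so they alternate with the m + 1 letters outside D,
   each of which occurs at two positions 2m + 2 apart.  This determines the code.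
   Conversely, that word is the interleaving of two cyclic words, on m + 1 and
   2m + 1 letters, which makes its distances explicit. *)

(** * Walks and distance in a finite graph *)

Section GraphDistance.
Variables (T : finType) (e : rel T).
Implicit Types (x y : T) (p : seq T).

Lemma gdist_le x p : path e x p -> gdist e x (last x p) <= size p.
Proof.
(* A walk with at least [#|T|] edges is covered by the default: the minimum never exceeds [#|T|]. *)
move=> xp; rewrite /gdist; case: (ltnP (size p) #|T|) => [ltp|lep]; last first.
  apply: leq_trans lep; elim/big_ind: _ => // [a b a_le _|i _].
    exact: leq_trans (geq_minl a b) a_le.
  exact: ltnW.
set P := BIG_P.
have: Ordinal ltp \in index_enum _ by rewrite mem_index_enum.
have: P (Ordinal ltp).
  by apply/existsP; exists (in_tuple p); rewrite xp eqxx.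
elim: (index_enum _) => // i s IHs Pi; rewrite big_cons inE => /predU1P[<-|sp].
  by rewrite Pi geq_minl.
case: ifP => _; last exact: IHs.
exact: leq_trans (geq_minr _ _) (IHs Pi sp).
Qed.

Lemma gdist_ge x y b : b <= #|T| ->
  (forall p, path e x p -> last x p = y -> b <= size p) -> b <= gdist e x y.
Proof.
move=> leb bP; rewrite /gdist; elim/big_ind: _ => // [a c lea lec|i].
  by rewrite leq_min lea.
by case/existsP=> p /andP[xp /eqP lp]; rewrite -(size_tuple p) bP.
Qed.

Lemma gdist_sym_le x y : symmetric e -> gdist e x y <= gdist e y x.
Proof.
move=> e_sym; apply: gdist_ge => [|p yp lp].
  rewrite /gdist; elim/big_ind: _ => // [a b a_le _|i _].
    exact: leq_trans (geq_minl a b) a_le.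
  exact: ltnW.
have rp: path e x (rev (belast y p)).
  by rewrite -lp rev_path (eq_path (e' := e)) // => u v; rewrite e_sym.
have := gdist_le rp; rewrite size_rev size_belast.
suff -> : last x (rev (belast y p)) = y by [].
by case: p lp {yp rp} => [|z p] //= _; rewrite rev_cons last_rcons.
Qed.

Lemma gdist_sym x y : symmetric e -> gdist e x y = gdist e y x.
Proof. by move=> es; apply/eqP; rewrite eqn_leq !gdist_sym_le. Qed.

End GraphDistance.

(** * Distance along a cycle *)

Section CyclicIndexing.
Variables (T : finType) (x0 : T) (c : seq T).
Hypotheses (c_uniq : uniq c) (c_gt0 : 0 < size c).

Definition cyc_nth i := nth x0 c (i %% size c).

Lemma mem_cyc_nth i : cyc_nth i \in c.
Proof. by rewrite mem_nth // ltn_pmod. Qed.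

Lemma cyc_nth_mod i j : i = j %[mod size c] -> cyc_nth i = cyc_nth j.
Proof. by rewrite /cyc_nth => ->. Qed.

Lemma cyc_nth_inj i j : cyc_nth i = cyc_nth j -> i = j %[mod size c].
Proof. by move/eqP; rewrite nth_uniq ?ltn_pmod // => /eqP. Qed.

Lemma cyc_nthP y : y \in c -> exists2 i, i < size c & y = cyc_nth i.
Proof.
move=> cy; exists (index y c); first by rewrite index_mem.
by rewrite /cyc_nth modn_small ?index_mem // nth_index.
Qed.

Lemma next_cyc_nth i : next c (cyc_nth i) = cyc_nth i.+1.
Proof.
rewrite next_nth mem_cyc_nth index_uniq ?ltn_pmod // /cyc_nth.
case: c c_gt0 => //= y p _; rewrite -[i.+1]addn1 -modnDml addn1.
have: i %% (size p).+1 < (size p).+1 by rewrite ltn_pmod.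
rewrite ltnS leq_eqVlt => /predU1P[->|lti].
  by rewrite modnn /= nth_default.
by rewrite [in RHS]modn_small //=; apply: set_nth_default.
Qed.

Lemma cycle_adj_sym : symmetric (cycle_adj c).
Proof. by move=> x y; rewrite /cycle_adj orbC andbCA. Qed.

Lemma gdist_cycle_le i j : i <= j ->
  gdist (cycle_adj c) (cyc_nth i) (cyc_nth j) <= j - i.
Proof.
move=> leij; rewrite -{1}(subnKC leij); move: (j - i) => {leij} l.
pose p := [seq cyc_nth t | t <- iota i.+1 l].
have lp : last (cyc_nth i) p = cyc_nth (i + l).
  rewrite /p (last_map cyc_nth); congr cyc_nth; elim: l {p} i => [|l IHl] i /=.
    by rewrite addn0.
  by rewrite IHl addSnnS.
rewrite -lp -[leqRHS](size_iota i.+1) -(size_map cyc_nth); apply: gdist_le.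
rewrite {lp}/p; elim: l i => //= l IHl i; rewrite IHl andbT.
by rewrite /cycle_adj !mem_cyc_nth next_cyc_nth eqxx.
Qed.

(** A walk with [a] forward and [b] backward steps reaches [j] only if [i + a] and [j + b] agree
    modulo [size c], so [a + b] is at least the length of one of the two arcs. *)
Lemma gdist_cycle_ge i j : i <= j <= i + size c ->
  minn (j - i) (size c - (j - i)) <= gdist (cycle_adj c) (cyc_nth i) (cyc_nth j).
Proof.
move=> leij; apply: gdist_ge => [|p].
  by have := max_card (mem c); rewrite (card_uniqP c_uniq); lia.
move=> ip lp.
(* A backward step is written as [(size c).-1] forward ones, to avoid subtraction. *)
have [a [b [sz_p last_p]]] : exists a b,
    a + b = size p /\ last (cyc_nth i) p = cyc_nth (i + a + b * (size c).-1).
  elim: p i {leij lp} ip => [|y p IHp] i /=.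
    by exists 0, 0; rewrite mul0n !addn0.
  case/andP=> /and3P[_ cy adj] yp.
  have [i1 _ y_i1] := cyc_nthP cy.
  move: yp; rewrite y_i1 => /IHp[a [b [<- ->]]].
  case/orP: adj => /eqP; rewrite y_i1 next_cyc_nth => /cyc_nth_inj.
    move=> E; exists a.+1, b; split=> //; apply: cyc_nth_mod.
    by rewrite -!addnA -[LHS]modnDml -E modnDml; congr (_ %% _); lia.
  move=> E; exists a, b.+1; split; first by rewrite addnS.
  apply: cyc_nth_mod; rewrite -!addnA -[RHS]modnDml -E modnDml.
  have -> : i1.+1 + (a + b.+1 * (size c).-1)
    = (i1 + (a + b * (size c).-1)) + size c by nia.
  by rewrite modnDr.
have /cyc_nth_inj E : cyc_nth (i + a + b * (size c).-1) = cyc_nth j.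
  by rewrite -last_p.
have {}E : i + a = j + b %[mod size c].
  rewrite -[RHS]modnDml -E modnDml.
  have -> : i + a + b * (size c).-1 + b = b * size c + (i + a) by nia.
  by rewrite modnMDl.
case: (leqP (i + a) (j + b)) => le_ab.
  have /dvdnP[q Eq] : size c %| (j + b) - (i + a) by rewrite -eqn_mod_dvd ?E.
  case: q Eq => [|q] Eq; nia.
have /dvdnP[q Eq] : size c %| (i + a) - (j + b).
  by rewrite -eqn_mod_dvd ?E // ltnW.
lia.
Qed.

End CyclicIndexing.

(** * Hamming distance as the metric of the cube *)

Definition hamming d (u v : cube d) := \sum_a (u a != v a).

Section Hamming.
Variable d : nat.
Implicit Types u v w : cube d.

Lemma cube_adjE u v : cube_adj u v = (hamming u v == 1).
Proof.
rewrite /cube_adj /hamming -sum1_card big_mkcond /=.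
by congr (_ == _); apply: eq_bigr => a _; rewrite inE; case: (_ != _).
Qed.

Lemma hammingxx u : hamming u u = 0.
Proof. by rewrite /hamming big1 // => a _; rewrite eqxx. Qed.

Lemma hammingC u v : hamming u v = hamming v u.
Proof. by apply: eq_bigr => a _; rewrite eq_sym. Qed.

Lemma hamming_eq0 u v : hamming u v = 0 -> u = v.
Proof.
move/eqP; rewrite sum_nat_eq0 => /forallP uv; apply/ffunP=> a.
by apply/eqP; have := uv a; rewrite eqb0 negbK.
Qed.

Lemma hamming_triangle u v w : hamming u w <= hamming u v + hamming v w.
Proof.
rewrite /hamming -big_split leq_sum //= => a _.
by case: (u a); case: (v a); case: (w a).
Qed.

Lemma odd_hamming u v w : odd (hamming u w) = odd (hamming u v + hamming v w).
Proof.
rewrite /hamming -big_split /=.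
apply: (big_ind2 (fun a b => odd a = odd b)) => // [x y z t Exy Ezt|a _].
  by rewrite !oddD Exy Ezt.
by case: (u a); case: (v a); case: (w a).
Qed.

Lemma hamming_le_dim u v : hamming u v <= d.
Proof.
rewrite -[leqRHS]card_ord -sum1_card; apply: leq_sum => a _; exact: leq_b1.
Qed.

(** Correcting the differing coordinates one at a time gives a walk of this length; the triangle
    inequality bounds every walk from below. *)
Lemma gdist_cubeE u v : gdist (@cube_adj d) u v = hamming u v.
Proof.
apply/eqP; rewrite eqn_leq; apply/andP; split.
  have [p [up <- <-]] : exists p : seq (cube d),
      [/\ path (@cube_adj d) u p, last u p = v & size p = hamming u v].
    move E: (hamming u v) => l; elim: l u E => [|l IHl] u uv.
      by exists [::]; split=> //; apply: hamming_eq0.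
    have /existsP[a uva] : [exists a, u a != v a].
      apply/contra_eqT: uv => /existsPn uv; rewrite /hamming big1 // => a _.
      by rewrite (negbTE (uv a)).
    pose u' : cube d := [ffun b => if b == a then v a else u b].
    have uu' : hamming u u' = 1.
      rewrite /hamming (bigD1 a) //= big1 ?ffunE ?eqxx ?uva // => b nba.
      by rewrite ffunE (negbTE nba) eqxx.
    have u'v : hamming u' v = l.
      apply/eqP; rewrite -eqSS -uv /hamming (bigD1 a) //= [in eqbRHS](bigD1 a) //=.
      rewrite uva ffunE !eqxx add0n add1n eqSS; apply/eqP/eq_bigr => b nba.
      by rewrite ffunE (negbTE nba).
    have [p [u'p lp sp]] := IHl _ u'v.
    by exists (u' :: p); rewrite /= cube_adjE uu' u'p lp sp.
  exact: gdist_le.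
apply: gdist_ge => [|p up <-].
  rewrite (leq_trans (hamming_le_dim u v)) // card_ffun card_bool card_ord.
  exact/ltnW/ltn_expl.
elim: p u up => [|w p IHp] u /=; first by rewrite hammingxx.
case/andP; rewrite cube_adjE => /eqP uw /IHp.
have := hamming_triangle u w (last w p); rewrite uw add1n => le1 le2.
exact: leq_trans le1 _.
Qed.

End Hamming.

(** A symmetric code of length [2n], unrolled over all natural indices. For [j <= i + n] the
    distance along the cycle is [j - i]. *)
Definition symmetric_walk d k n (x : nat -> cube d) (tau : nat -> 'I_d) : Prop :=
  [/\ forall i a, x i.+1 a = x i a (+) (a == tau i),
      forall i, tau (i + n) = tau i
    & forall i j, i <= j <= i + n -> minn (j - i) k <= hamming (x i) (x j)].

Lemma symmetric_walk_shift d k n (x : nat -> cube d) tau s :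
  symmetric_walk k n x tau ->
  symmetric_walk k n (fun i => x (s + i)) (fun i => tau (s + i)).
Proof.
case=> step per spread; split=> [i a|i|i j leij].
- by rewrite addnS step.
- by rewrite addnA per.
- by rewrite -(subnDl s) spread //; lia.
Qed.

Lemma sum_pred1 (I : finType) (b : I) : \sum_a (a == b) = 1.
Proof. by rewrite (bigD1 b) //= eqxx big1 // => a /negbTE ->. Qed.

(** * Distances and repeated letters in a symmetric walk *)

Section SymmetricWalk.
Variables (d k n : nat) (x : nat -> cube d) (tau : nat -> 'I_d).
Hypothesis wx : symmetric_walk k n x tau.

Let step i a : x i.+1 a = x i a (+) (a == tau i).
Proof. by case: wx. Qed.

Let per i : tau (i + n) = tau i.
Proof. by case: wx. Qed.

Let spread i j : i <= j <= i + n -> minn (j - i) k <= hamming (x i) (x j).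
Proof. by case: wx => _ _; apply. Qed.

Lemma hamming_step i : hamming (x i) (x i.+1) = 1.
Proof.
rewrite -[RHS](sum_pred1 (tau i)); apply: eq_bigr => a _; rewrite step.
by case: (x i a); case: (a == _).
Qed.

Lemma hamming_walk_le i l : hamming (x i) (x (i + l)) <= l.
Proof.
elim: l => [|l IHl]; first by rewrite addn0 hammingxx.
rewrite (leq_trans (hamming_triangle _ (x (i + l)) _)) // addnS hamming_step.
by rewrite addn1.
Qed.

Lemma odd_hamming_walk i l : odd (hamming (x i) (x (i + l))) = odd l.
Proof.
elim: l => [|l IHl]; first by rewrite addn0 hammingxx.
by rewrite (odd_hamming _ (x (i + l))) oddD IHl addnS hamming_step addbT.
Qed.

Lemma spread_ge i l : k <= l <= n -> k <= hamming (x i) (x (i + l)).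
Proof.
move=> lel.
have: minn (i + l - i) k <= hamming (x i) (x (i + l)) by apply: spread; lia.
rewrite addKn; move: (hamming _ _) => h; lia.
Qed.

(** The distance has the parity of [l], so for odd [l] it cannot equal the even [k]. *)
Lemma spread_parity i l : ~~ odd k -> k <= l <= n ->
  k + odd l <= hamming (x i) (x (i + l)).
Proof.
move=> ev_k lP; have := spread_ge i lP; rewrite leq_eqVlt => /predU1P[E|lt].
  by rewrite -(odd_hamming_walk i l) -E (negbTE ev_k) addn0.
by rewrite (leq_trans _ lt) // -addn1 leq_add2l leq_b1.
Qed.

Definition antipodal_diff a := x 0 a != x n a.
Local Notation D := antipodal_diff.
Definition weight := \sum_a D a.
Local Notation delta := weight.

Lemma walk_antipode i a : x (i + n) a = x i a (+) D a.
Proof.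
elim: i => [|i IHi]; first by rewrite add0n /D; case: (x 0 a); case: (x n a).
by rewrite addSn !step per IHi addbAC.
Qed.

Lemma antipodal_diff_shift s a : (x s a != x (s + n) a) = D a.
Proof. by rewrite walk_antipode; case: (x s a); case: (D a). Qed.

Definition codist i j := \sum_a (~~ D a && (x i a != x j a)).

(** A coordinate in [D] separates [x j] from exactly one of [x i] and [x (i + n)]; one outside [D]
    separates it from both or neither. *)
Lemma hamming_antipode i j :
  hamming (x i) (x j) + hamming (x j) (x (i + n)) = delta + 2 * codist i j.
Proof.
rewrite /hamming /delta /codist big_distrr /= -!big_split; apply: eq_bigr => a _ /=.
by rewrite walk_antipode; case: (x i a); case: (x j a); case: (D a).
Qed.

(** The point [x (i + l)] cuts the walk from [x i] to [x (i + n)] into arcs of lengths [l] and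
    [n - l], and [spread_parity] applies to both. *)
Lemma codist_ge i l : ~~ odd k -> k <= l -> l + k <= n ->
  (k + odd l) + (k + (odd n (+) odd l)) <= delta + 2 * codist i (i + l).
Proof.
move=> ev_k le_l le_n; have le_ln : l <= n := leq_trans (leq_addr k l) le_n.
rewrite -hamming_antipode -oddB //.
have -> : i + n = i + l + (n - l) by rewrite -addnA subnKC.
apply: leq_add; apply: spread_parity; rewrite ?le_l ?le_ln //.
by rewrite leq_subr andbT leq_subRL.
Qed.

(** Among three bits 0 or 2 pairs are unequal, so a coordinate outside [D] adds at most 2; one in
    [D] adds 2 through [2 * delta]. *)
Lemma codist_triangle i j l : codist i j + codist j l + codist i l + 2 * delta <= 2 * d.
Proof.
rewrite -[in 2 * d](card_ord d) -sum1_card /delta /codist !big_distrr /= -!big_split.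
apply: leq_sum => a _ /=.
by case: (D a); case: (x i a); case: (x j a); case: (x l a).
Qed.

Lemma odd_codist_step i j : ~~ D (tau j) -> odd (codist i j.+1) = ~~ odd (codist i j).
Proof.
move=> Dj; have <- : odd (codist i j + 1) = ~~ odd (codist i j) by rewrite addn1.
rewrite -(sum_pred1 (tau j)) /codist -big_split /=.
apply: (big_ind2 (fun a b => odd a = odd b)) => // [a b a' b' Eab Eab'|a _].
  by rewrite !oddD Eab Eab'.
rewrite step; case: (a =P tau j) => [->|_]; last by rewrite addbF addn0.
by rewrite Dj; case: (x i _); case: (x j _).
Qed.

Lemma walk_occurs i l a : x i a != x (i + l) a ->
  exists2 t, i <= t < i + l & tau t = a.
Proof.
elim: l => [|l IHl]; first by rewrite addn0 eqxx.
rewrite addnS step; case: (a =P tau (i + l)) => [-> _|_].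
  by exists (i + l) => //; lia.
by rewrite addbF => /IHl[t tP <-]; exists t => //; lia.
Qed.

Lemma weight_remove i : D (tau i) -> hamming (x i.+1) (x (i + n)) + 1 = delta.
Proof.
move=> Di; rewrite -(sum_pred1 (tau i)) -big_split; apply: eq_bigr => a _ /=.
rewrite walk_antipode step; case: (a =P tau i) => [->|_].
  by rewrite Di; case: (x i _).
by case: (x i a); case: (D a).
Qed.

Hypothesis lt_kn : k < n.

(** The two equal flips cancel, so [x i] and [x j.+1] are as close as [x i.+1] and [x j], at most
    [j - i - 1] apart; for [j <= i + k] the spread forbids this. *)
Lemma transition_gap i j : i < j -> tau i = tau j -> i + k < j.
Proof.
move=> ltij tij; rewrite ltnNge; apply/negP => lej.
have E : hamming (x i) (x j.+1) = hamming (x i.+1) (x j).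
  apply: eq_bigr => a _; rewrite !step tij.
  by case: (x i a); case: (x j a); case: (a == _).
have: minn (j.+1 - i) k <= hamming (x i) (x j.+1) by apply: spread; lia.
have := hamming_walk_le i.+1 (j - i.+1); rewrite subnKC // E.
move: (hamming _ _) => h; lia.
Qed.

Lemma transition_gap_cyclic i j : i < n -> j < n -> i != j -> tau i = tau j ->
  (i + k < j /\ j + k < i + n) \/ (j + k < i /\ i + k < j + n).
Proof.
move=> lti ltj; rewrite neq_ltn => /orP[lt_ij|lt_ji] tij; [left|right].
  by split; apply: transition_gap => //; [lia | rewrite per].
by split; apply: transition_gap => //; [lia | rewrite per].
Qed.

Lemma weight_remove2 i : 0 < k -> D (tau i) -> D (tau i.+1) ->
  hamming (x i.+2) (x (i + n)) + 2 = delta.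
Proof.
move=> k_gt0 Di Di1; have ne_t : tau i != tau i.+1.
  apply/eqP=> E; have := transition_gap (ltnSn i) E; lia.
have -> : 2 = \sum_a (a == tau i) + \sum_a (a == tau i.+1).
  by rewrite !sum_pred1.
rewrite -!big_split; apply: eq_bigr => a _ /=.
rewrite walk_antipode !step; case: (a =P tau i) => [->|_].
  by rewrite Di (negbTE ne_t); case: (x i _).
case: (a =P tau i.+1) => [->|_]; first by rewrite Di1; case: (x i _).
by case: (x i a); case: (D a).
Qed.

Lemma lt_spread_weight : 0 < k -> k < delta.
Proof.
move=> k_gt0.
have le_k : k <= delta by apply: (spread_ge 0); lia.
(* As [k > 0], some letter lies in [D]; deleting its transition leaves a window of [n - 1 >= k]
   steps. *)
have /existsP[a Da] : [exists a, D a].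
  apply: contraLR le_k => /existsPn nD; rewrite -ltnNge /delta big1 // => a _.
  by rewrite (negbTE (nD a)).
have [t tP ta] : exists2 t, 0 <= t < 0 + n & tau t = a by apply: walk_occurs.
rewrite -ta in Da; rewrite -(weight_remove Da) addn1 ltnS.
have -> : t + n = t.+1 + n.-1 by lia.
by apply: spread_ge; lia.
Qed.

Definition occ a := \sum_(i < n) (a == tau i).

Lemma odd_occ a : odd (occ a) = D a.
Proof.
suff E j : x j a = x 0 a (+) odd (\sum_(i < j) (a == tau i)).
  by rewrite /D (E n) -/(occ a); case: (x 0 a); case: (odd _).
elim: j => [|j IHj]; first by rewrite big_ord0 addbF.
by rewrite step IHj big_ord_recr /= oddD oddb addbA.
Qed.

Lemma sum_occ : \sum_a occ a = n.
Proof.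
rewrite exchange_big /= (eq_bigr (fun _ => 1)); first by rewrite sum1_card card_ord.
by move=> i _; rewrite sum_pred1.
Qed.

Lemma occE a : occ a = #|[set i : 'I_n | a == tau i]|.
Proof.
rewrite -sum1_card big_mkcond; apply: eq_bigr => i _ /=.
by rewrite inE; case: (_ == _).
Qed.

(** Three occurrences would cut the cyclic half period into three gaps of at least [k + 1] each. *)
Lemma occ_le2 a : n < 3 * k.+1 -> occ a <= 2.
Proof.
move=> lt_n; rewrite occE leqNgt; apply/negP=> /card_gt2P.
case=> i [j [l [+ [ij jl li]]]]; rewrite !inE => -[/eqP ai /eqP aj /eqP al].
have [[lti ltj] ltl] := (ltn_ord i, ltn_ord j, ltn_ord l).
have := transition_gap_cyclic lti ltj ij (etrans (esym ai) aj).
have := transition_gap_cyclic ltj ltl jl (etrans (esym aj) al).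
have := transition_gap_cyclic ltl lti li (etrans (esym al) ai).
lia.
Qed.

Lemma occ_le a : n < 3 * k.+1 -> occ a + D a <= 2.
Proof. by move/(occ_le2 a); rewrite -odd_occ; case: (occ a) => [|[|[|]]]. Qed.

Lemma length_weight_le : n < 3 * k.+1 -> n + delta <= 2 * d.
Proof.
move=> lt_n; rewrite -sum_occ /delta -big_split /= -[in 2 * d](card_ord d).
by rewrite -sum1_card big_distrr /=; apply: leq_sum => a _; apply: occ_le.
Qed.

End SymmetricWalk.

(** * Excluding half periods of length at least [3 (k + 1)] *)

Section LongWalk.
Variables (m d n : nat) (x : nat -> cube d) (tau : nat -> 'I_d).
Hypotheses (m_gt1 : 1 < m) (dE : d = 3 * m + 2) (large : 6 * m + 3 <= n).
Hypothesis wx : symmetric_walk (2 * m) n x tau.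

Let ev_k : ~~ odd (2 * m). Proof. by rewrite oddM. Qed.

Let lt_weight : 2 * m < weight n x.
Proof. by apply: (lt_spread_weight wx); lia. Qed.

(* Two arcs of odd length: parity strengthens the bounds and gives #|D| <= 4. *)
Lemma long_walk_odd : odd n.
Proof.
apply/negP=> /negP ev_n; pose p := (2 * m).+1.
have odd_p : odd p by rewrite /= oddM.
have v1 : _ := codist_ge wx 0 (l := p) ev_k.
have v2 : _ := codist_ge wx (0 + p) (l := p) ev_k.
have v3 : _ := codist_ge wx 0 (l := p + p) ev_k.
have t := codist_triangle n x 0 (0 + p) (0 + p + p).
rewrite (negbTE ev_n) odd_p /= in v1 v2.
rewrite (negbTE ev_n) oddD odd_p (addnA 0 p p) /= in v3.
move: v1 v2 v3 t lt_weight; move: (codist _ _ _ _) (codist _ _ _ _) (codist _ _ _ _).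
rewrite /p; move: (weight n x) => w a b c; lia.
Qed.

(* Only m = 2 and #|D| = 5 survive, and every codist equals 2. *)
Lemma long_walk_codist s r : r <= 1 ->
  codist n x (s + 2 * m) (s + 2 * m + (2 * m + r)) = 2.
Proof.
move=> le_r.
have v_ge i l : 2 * m <= l -> l + 2 * m <= n ->
    (4 * m).+1 <= weight n x + 2 * codist n x i (i + l).
  move=> le_l le_n; apply: leq_trans (codist_ge wx i ev_k le_l le_n).
  rewrite long_walk_odd; move: (odd l) => [] /=; lia.
have v1 : _ := v_ge s (2 * m).
have v2 : _ := v_ge (s + 2 * m) (2 * m + r).
have v3 : _ := v_ge s (2 * m + (2 * m + r)); rewrite (addnA s) in v3.
have t := codist_triangle n x s (s + 2 * m) (s + 2 * m + (2 * m + r)).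
move: v1 v2 v3 t lt_weight; move: (codist _ _ _ _) (codist _ _ _ _) (codist _ _ _ _).
move: (weight n x) => w a b c; clear v_ge; lia.
Qed.

(* Moving an end point across a transition outside D changes the parity of codist. *)
Lemma long_walk_absurd : False.
Proof.
have [a /andP[Da xa]] : exists a, ~~ antipodal_diff n x a &&
    (x (0 + 2 * m) a != x (0 + 2 * m + (2 * m + 0)) a).
  apply/existsP; apply/contraT => /existsPn E.
  have := long_walk_codist 0 (leq0n 1); rewrite /codist big1 // => b _.
  by rewrite (negbTE (E b)).
have [t tP ta] := walk_occurs wx xa.
(* This makes [s + 4m] equal to [t + n], a position whose letter is outside [D]; adding [n] keeps
   the subtraction exact. *)
pose s := t + n - 4 * m; have Es : s + 2 * m + 2 * m = t + n by rewrite /s; lia.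
have v0 := long_walk_codist s (leq0n 1); have := long_walk_codist s (leqnn 1).
rewrite addn0 in v0; rewrite addn1 addnS => v1; have [_ per _] := wx.
have Dt : ~~ antipodal_diff n x (tau (s + 2 * m + 2 * m)) by rewrite Es per ta.
by have := odd_codist_step wx (s + 2 * m) Dt; rewrite v1 v0.
Qed.

End LongWalk.

Lemma symmetric_walk_length m d n (x : nat -> cube d) tau :
  1 < m -> d = 3 * m + 2 -> symmetric_walk (2 * m) n x tau -> n <= 4 * m + 3.
Proof.
move=> m_gt1 dE wx; case: (leqP (6 * m + 3) n) => [large|small].
  by case: (long_walk_absurd m_gt1 dE large wx).
rewrite leqNgt; apply/negP=> lt_n; have lt_kn : 2 * m < n by lia.
have lt_w : 2 * m < weight n x by apply: (lt_spread_weight wx lt_kn); lia.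
have := length_weight_le wx lt_kn; move: (weight n x) lt_w => w; lia.
Qed.

(** * Structure and uniqueness at the extremal length *)

Lemma eq_sum_le (I : finType) (F G : I -> nat) :
  (forall i, F i <= G i) -> \sum_i F i = \sum_i G i -> F =1 G.
Proof.
move=> leFG E i; have: \sum_(j | j != i) F j <= \sum_(j | j != i) G j.
  exact: leq_sum.
by move: E (leFG i); rewrite (bigD1 i) //= [in RHS](bigD1 i) //=; lia.
Qed.

Lemma big_ord_double M (f : nat -> nat) :
  \sum_(i < M.*2) f i = \sum_(j < M) (f j.*2 + f j.*2.+1).
Proof.
elim: M => [|M IHM]; first by rewrite !big_ord0.
by rewrite doubleS !big_ord_recr /= IHM addnA.
Qed.

Section ExtremalWalk.
Variables (m d n : nat) (x : nat -> cube d) (tau : nat -> 'I_d).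
Hypotheses (m_gt0 : 0 < m) (dE : d = 3 * m + 2) (nE : n = 4 * m + 3).
Hypothesis wx : symmetric_walk (2 * m) n x tau.
Local Notation D := (antipodal_diff n x).

Let lt_kn : 2 * m < n. Proof. lia. Qed.

Let small_n : n < 3 * (2 * m).+1. Proof. lia. Qed.

Lemma extremal_weight : weight n x = (2 * m).+1.
Proof.
have := length_weight_le wx lt_kn small_n.
have : 2 * m < weight n x by apply: (lt_spread_weight wx lt_kn); lia.
lia.
Qed.

(** Both sides have the same sum over all letters, so the bound of [occ_le] is attained by each. *)
Lemma extremal_occ a : occ n tau a + D a = 2.
Proof.
move: a; apply: eq_sum_le => [a|]; first exact: (occ_le wx lt_kn).
rewrite big_split /= sum_occ -/(weight n x) extremal_weight big_const_ord.
by rewrite iter_addn; lia.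
Qed.

(** Deleting two adjacent transitions of [D] would leave distance [2m - 1] across [n - 2 >= 2m]
    steps. *)
Lemma extremal_not_adjacent i : D (tau i) -> ~~ D (tau i.+1).
Proof.
move=> Di; apply/negP=> Di1.
have := weight_remove2 wx lt_kn _ Di Di1; rewrite muln_gt0 m_gt0 => /(_ isT).
have -> : i + n = i.+2 + (n - 2) by lia.
have : 2 * m <= hamming (x i.+2) (x (i.+2 + (n - 2))) by apply: (spread_ge wx); lia.
rewrite extremal_weight; lia.
Qed.

Lemma extremal_sum : \sum_(i < n) D (tau i) = (2 * m).+1.
Proof.
rewrite -extremal_weight.
rewrite (eq_bigr (fun i : 'I_n => \sum_a D a * (a == tau i))); last first.
  move=> i _; rewrite (bigD1 (tau i)) //= eqxx muln1 big1 ?addn0 // => a.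
  by move/negbTE->; rewrite muln0.
rewrite exchange_big /=; apply: eq_bigr => a _.
rewrite -big_distrr /= -/(occ n tau a).
by have := extremal_occ a; case: (D a) => /= [|_]; [lia | rewrite mul0n].
Qed.

(** Otherwise membership in [D] would alternate all round a cyclic half period of odd length. *)
Lemma extremal_adjacent : exists i, ~~ D (tau i) && ~~ D (tau i.+1).
Proof.
case: (pickP (fun i : 'I_n => ~~ D (tau i) && ~~ D (tau i.+1))) => [i Pi|none].
  by exists i.
have [_ per _] := wx.
have alt i : i < n -> D (tau i.+1) = ~~ D (tau i).
  move=> lti; have := none (Ordinal lti); have := @extremal_not_adjacent i.
  by rewrite /=; case: (D _) => [/(_ isT)/negbTE //|_]; case: (D _).
have /(_ n (leqnn n)) : forall i, i <= n -> D (tau i) = D (tau 0) (+) odd i.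
  elim=> [|i IHi] lei; first by rewrite addbF.
  by rewrite alt // IHi 1?ltnW // addbN.
by rewrite -[in tau n](add0n n) per; case: (D _); lia.
Qed.

(** * Half periods cut between two adjacent letters outside [D] *)

Section Normalised.
Hypotheses (D0 : ~~ D (tau 0)) (Dlast : ~~ D (tau n.-1)).

(** Without position 0 there remain [2m + 1] adjacent pairs, each with at most one transition in
    [D]; by [extremal_sum] each has exactly one. *)
Lemma normalised_parity i : i < n -> D (tau i) = odd i.
Proof.
have pair (j : 'I_(2 * m).+1) : D (tau j.*2.+1) + D (tau j.*2.+2) = 1.
  move: j; apply: (eq_sum_le (G := fun=> 1)) => [j|].
    have := @extremal_not_adjacent j.*2.+1.
    by case: (D (tau j.*2.+1)) => [/(_ isT)/negbTE-> //|_]; apply: leq_b1.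
  rewrite sum1_card card_ord -[RHS]extremal_sum.
  rewrite -(big_ord_double _ (fun i => nat_of_bool (D (tau i.+1)))).
  have -> : \sum_(i < n) D (tau i) = \sum_(i < n.-1.+1) D (tau i).
    by rewrite prednK // nE addn3.
  rewrite big_ord_recl (negbTE D0) add0n.
  by have -> : n.-1 = ((2 * m).+1).*2 by lia.
(* The induction descends from the last position, [4m + 2]. *)
have even j : j <= (2 * m).+1 -> ~~ D (tau ((2 * m).+1 - j).*2).
  elim: j => [_|j IHj ltj]; first by move: Dlast; congr (~~ D (tau _)); lia.
  have := IHj (ltnW ltj); have ltj' : (2 * m).+1 - j.+1 < (2 * m).+1 by lia.
  have -> : ((2 * m).+1 - j).*2 = ((2 * m).+1 - j.+1).*2.+2 by lia.
  move/negbTE=> D2; apply/negP=> /extremal_not_adjacent/negbTE D1.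
  by have := pair (Ordinal ltj'); rewrite /= D1 D2.
move=> lti; case odd_i: (odd i).
  have lth : i./2 < (2 * m).+1 by lia.
  have := pair (Ordinal lth) => /=.
  have -> : (i./2).*2.+2 = ((2 * m).+1 - (2 * m - i./2)).*2 by lia.
  rewrite (negbTE (even _ _)); last by lia.
  have -> : (i./2).*2.+1 = i by lia.
  by case: (D _).
have -> : i = ((2 * m).+1 - ((2 * m).+1 - i./2)).*2 by lia.
by apply/negbTE/even; lia.
Qed.

(** A repeated letter is outside [D], so [p] and [q] are even. The two cyclic gaps exceed [2m] and
    add up to [4m + 3], so the even one is [2m + 2]. *)
Lemma normalised_repeat p q : p < q -> q < n -> tau p = tau q ->
  ~~ odd p /\ q = p + (2 * m).+2.
Proof.
move=> ltpq ltq tpq; have ltp := ltn_trans ltpq ltq.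
have := transition_gap_cyclic wx lt_kn ltp ltq; rewrite ltn_eqF // => /(_ isT tpq).
have := normalised_parity ltp; have := normalised_parity ltq; rewrite tpq => -> par.
suff : ~~ D (tau p) by rewrite normalised_parity //; lia.
have : 1 < occ n tau (tau p).
  rewrite occE; apply/card_gt1P; exists (Ordinal ltp), (Ordinal ltq).
  by rewrite !inE /= tpq eqxx -val_eqE /= ltn_eqF.
by have := extremal_occ (tau p); case: (D _); lia.
Qed.

Lemma normalised_paired p : ~~ odd p -> p + (2 * m).+2 < n ->
  tau p = tau (p + (2 * m).+2).
Proof.
move=> ev_p ltp; have ltpn : p < n by lia.
have : 1 < occ n tau (tau p).
  by have := extremal_occ (tau p); rewrite normalised_parity // (negbTE ev_p); lia.
rewrite occE => /card_gt1P[i [j []]]; rewrite !inE => /eqP ti /eqP tj nij.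
have [q [ltq nqp tq]] : exists q, [/\ q < n, q != p & tau p = tau q].
  case: (eqVneq (i : nat) p) => [Ei|ni]; last by exists i.
  by exists j; split=> //; rewrite -Ei eq_sym.
move: nqp; rewrite neq_ltn => /orP[lt|lt].
  by have [] := normalised_repeat lt ltpn (esym tq); lia.
by have [_ <-] := normalised_repeat lt ltq tq.
Qed.

(** The equality pattern of the half period depends on [m] alone, which forces uniqueness up to
    renaming letters. *)
Lemma normalised_kernel p q : p < n -> q < n ->
  (tau p == tau q) = [|| p == q, ~~ odd p && (q == p + (2 * m).+2)
                              | ~~ odd q && (p == q + (2 * m).+2)].
Proof.
move=> ltp ltq; apply/eqP/idP => [tpq|].
  case: (ltngtP p q) => //= lt.
    by have [-> <-] := normalised_repeat lt ltq tpq; rewrite eqxx.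
  by have [-> <-] := normalised_repeat lt ltp (esym tpq); rewrite eqxx orbT.
case/or3P=> [/eqP-> // | /andP[ev /eqP E] | /andP[ev /eqP E]].
  by rewrite E; apply: normalised_paired; rewrite // -E.
by rewrite [in LHS]E; apply/esym/normalised_paired; rewrite // -E.
Qed.

End Normalised.

Lemma extremal_surj a : exists2 i, i < n & a = tau i.
Proof.
case: (pickP (fun i : 'I_n => a == tau i)) => [i /eqP ai|none]; first by exists i.
have := extremal_occ a; rewrite /occ big1; first by case: (D a).
by move=> i _; rewrite none.
Qed.

End ExtremalWalk.

Lemma walk_periodic d k n (x : nat -> cube d) tau i :
  symmetric_walk k n x tau -> tau (i %% n) = tau i.
Proof.
case=> _ per _; rewrite [in RHS](divn_eq i n) addnC.
by elim: (i %/ n) => [|q IHq]; rewrite ?addn0 // mulSn addnCA addnC per.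
Qed.

Lemma extremal_normalise m d (x : nat -> cube d) tau :
  0 < m -> d = 3 * m + 2 -> symmetric_walk (2 * m) (4 * m + 3) x tau ->
  exists s, forall p q, p < 4 * m + 3 -> q < 4 * m + 3 ->
  (tau (s + p) == tau (s + q)) = [|| p == q, ~~ odd p && (q == p + (2 * m).+2)
                                        | ~~ odd q && (p == q + (2 * m).+2)].
Proof.
move=> m_gt0 dE wx; have [t /andP[Dt Dt1]] := extremal_adjacent m_gt0 dE erefl wx.
have [_ per _] := wx.
(* Starting at [t.+1] puts the adjacent pair outside [D] at places [0] and [n - 1] of the half
   period. *)
exists t.+1; apply: (normalised_kernel m_gt0 dE erefl (symmetric_walk_shift t.+1 wx)).
  by rewrite /antipodal_diff addn0 (antipodal_diff_shift wx).
rewrite /antipodal_diff addn0 (antipodal_diff_shift wx).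
have -> : t.+1 + (4 * m + 3).-1 = t + (4 * m + 3) by lia.
by rewrite per.
Qed.

Lemma extremal_walk_unique m d (x x' : nat -> cube d) tau tau' :
  0 < m -> d = 3 * m + 2 ->
  symmetric_walk (2 * m) (4 * m + 3) x tau ->
  symmetric_walk (2 * m) (4 * m + 3) x' tau' ->
  exists r (sigma : {perm 'I_d}), forall i, tau' i = sigma (tau (r + i)).
Proof.
move=> m_gt0 dE wx wx'; set n := 4 * m + 3 in wx wx'.
have [s ker] := extremal_normalise m_gt0 dE wx.
have [s' ker'] := extremal_normalise m_gt0 dE wx'.
have ws := symmetric_walk_shift s wx; have ws' := symmetric_walk_shift s' wx'.
have surj := extremal_surj m_gt0 dE erefl ws.
(* The renaming of letters, well defined and injective because both words have the same equality
   pattern. By [surj] the default [a] is never taken. *)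
pose f a := oapp (fun i : 'I_n => tau' (s' + i)) a [pick i : 'I_n | a == tau (s + i)].
have fE i : f (tau (s + i)) = tau' (s' + i).
  rewrite -(walk_periodic i ws) -(walk_periodic i ws').
  have: i %% n < n by rewrite ltn_pmod // /n addn3.
  move: (i %% n) => {}i lti; rewrite /f; case: pickP => [j /=|].
    by move=> E; apply/eqP; rewrite ker' // -ker // eq_sym.
  by move/(_ (Ordinal lti)); rewrite /= eqxx.
have f_inj : injective f.
  move=> a b; have [i lti ->] := surj a; have [j ltj ->] := surj b.
  by rewrite !fE => E; apply/eqP; rewrite ker // -ker' // E.
(* The difference [s' * n - s'] stands for [-s'] modulo [n]. *)
exists (s + (s' * n - s')), (perm f_inj) => i.
rewrite permE -addnA fE addnA subnKC; last by rewrite leq_pmulr // /n addn3.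
by rewrite -(walk_periodic i wx') -[RHS](walk_periodic _ wx') modnMDl.
Qed.

(** * Passage between codes and symmetric walks *)

Lemma rot_mkseq (T : Type) (f : nat -> T) N r :
  (forall i, f (i + N) = f i) -> r <= N ->
  rot r (mkseq f N) = mkseq (fun i => f (r + i)) N.
Proof.
move=> per le_rN; rewrite /mkseq -map_rot /rot drop_iota take_iota add0n.
rewrite (minn_idPl le_rN) (map_comp f (addn r)) -iotaDl addn0.
rewrite -[in RHS](subnK le_rN) iotaD subnKC // !map_cat; congr (_ ++ _).
rewrite -[in RHS](addn0 N) iotaDl -map_comp; apply: eq_map => i /=.
by rewrite addnC per.
Qed.

Lemma pmap_map (T U V : Type) (f : U -> option V) (g : T -> U) (h : T -> V) s :
  (forall i, f (g i) = Some (h i)) -> pmap f (map g s) = map h s.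
Proof. by move=> fg; elim: s => //= i s ->; rewrite fg. Qed.

Section Transitions.
Variables (d : nat) (x : nat -> cube d) (tau : nat -> 'I_d).
Hypothesis step : forall i a, x i.+1 a = x i a (+) (a == tau i).

Lemma transitions_mkseq N : (forall i, x (i + N) = x i) -> 0 < N ->
  transitions (mkseq x N) = mkseq tau N.
Proof.
move=> per N_gt0; rewrite /transitions rot_mkseq // /mkseq zip_map.
apply: pmap_map => i /=; case: pickP => [a|none].
  by rewrite step; case: (a =P tau i) => [-> //|_]; rewrite addbF eqxx.
by have := none (tau i); rewrite step eqxx addbT; case: (x i _).
Qed.

Lemma transition_periodic N :
  (forall i, x (i + N) = x i) -> forall i, tau (i + N) = tau i.
Proof.
move=> per i; apply/esym/eqP; have := step (i + N) (tau i).
by rewrite -addSn !per step eqxx; case: (x i _); case: (_ == _).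
Qed.

End Transitions.

Lemma cube_walk_transitions d (a0 : 'I_d) (x : nat -> cube d) :
  (forall i, cube_adj (x i) (x i.+1)) ->
  exists tau : nat -> 'I_d, forall i a, x i.+1 a = x i a (+) (a == tau i).
Proof.
move=> adj; exists (fun i => odflt a0 [pick b | x i b != x i.+1 b]) => i a.
have /cards1P[b E] := adj i.
have {}E c : (x i c != x i.+1 c) = (c == b) by have /setP/(_ c) := E; rewrite !inE.
case: pickP => [c /=|/(_ b)]; last by rewrite E eqxx.
by rewrite E => /eqP->; rewrite -E; case: (x i a); case: (x i.+1 a).
Qed.

Lemma onth_mkseq (T : Type) (f : nat -> T) N i : i < N ->
  onth (mkseq f N) i = Some (f i).
Proof. by move=> lti; rewrite onthE -map_comp (nth_map 0) ?size_iota //= nth_iota. Qed.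

Lemma symmetric_code_walk d k (a0 : 'I_d) (c : seq (cube d)) :
  symmetric_code k c -> exists (x : nat -> cube d) tau,
  [/\ size c = (size c)./2.*2, symmetric_walk k (size c)./2 x tau,
      transitions c = mkseq tau (size c) & forall i, tau (i + size c) = tau i].
Proof.
case=> [[/and3P[c_gt2 c_cycle c_uniq] c_spread] c_sym].
have c_gt0 : 0 < size c by apply: leq_trans c_gt2.
pose x := cyc_nth [ffun=> false] c.
have adj i : cube_adj (x i) (x i.+1).
  by rewrite /x -next_cyc_nth // next_cycle // mem_cyc_nth.
have [tau step] := cube_walk_transitions a0 adj.
have x_per i : x (i + size c) = x i by apply: cyc_nth_mod; rewrite modnDr.
have tau_per := transition_periodic step x_per.
have c_trans : transitions c = mkseq tau (size c).
  rewrite -(transitions_mkseq step x_per c_gt0); congr transitions.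
  rewrite -[LHS](mkseq_nth [ffun=> false]); apply/eq_in_map => i.
  by rewrite mem_iota /x /cyc_nth => /andP[_ lti]; rewrite modn_small.
(* Each step changes the parity of the distance from the start, so a closed walk has even length. *)
have c_even : size c = (size c)./2.*2.
  have : odd (hamming (x 0) (x (size c))) = odd (size c).
    elim: (size c) => [|l IHl]; first by rewrite hammingxx.
    rewrite (odd_hamming _ (x l)) oddD IHl; have := adj l.
    by rewrite cube_adjE => /eqP->; rewrite addbT.
  by rewrite -[size c]add0n x_per hammingxx; lia.
exists x, tau; split=> //; split=> // [i|i j leij].
  (* Symmetry compares only the two halves of one period; other indices are reduced modulo
     [size c]. *)
  have tau_half r : r < (size c)./2 -> tau (r + (size c)./2) = tau r.
    move=> ltr; move: c_sym; rewrite c_trans => /(_ r); rewrite size_mkseq => /(_ ltr).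
    by rewrite !onth_mkseq; [case=> ->; rewrite addnC | lia | lia].
  have tau_mod q : tau (i %% size c + q) = tau (i + q).
    rewrite [in RHS](divn_eq i (size c)) -addnA.
    by elim: (i %/ _) => // l IHl; rewrite mulSn -addnA [in RHS]addnC tau_per.
  rewrite -tau_mod -[in RHS](addn0 i) -tau_mod addn0.
  have: i %% size c < size c by rewrite ltn_pmod.
  move: (i %% _) => r ltr; case: (ltnP r (size c)./2) => [|ler]; first exact: tau_half.
  rewrite -(subnK ler) [in RHS]tau_half; last by lia.
  by rewrite -addnA addnn -c_even tau_per.
have := c_spread _ _ (mem_cyc_nth [ffun=> false] c_gt0 i)
                     (mem_cyc_nth [ffun=> false] c_gt0 j).
rewrite gdist_cubeE; apply: leq_trans.
have leij2 : i <= j <= i + size c by move: leij c_even; move: (size c) => N; lia.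
have := gdist_cycle_ge [ffun=> false] c_uniq c_gt0 leij2.
move: (gdist _ _ _) leij c_even => g; move: (size c) => N; lia.
Qed.

(** Flipping [D] twice closes the walk after [2n] steps. Arcs longer than [n] are handled through
    the complementary arc. *)
Lemma symmetric_walk_code d k n (x : nat -> cube d) tau :
  0 < k -> 1 < n -> symmetric_walk k n x tau -> symmetric_code k (mkseq x n.*2).
Proof.
move=> k_gt0 n_gt1 wx; have [step per spread] := wx.
have x_per i : x (i + n.*2) = x i.
  apply/ffunP=> a; rewrite -addnn addnA !(walk_antipode wx).
  by case: (x i a); case: (antipodal_diff n x a).
have spread2 i j : i <= j <= i + n.*2 ->
    minn (minn (j - i) (i + n.*2 - j)) k <= hamming (x i) (x j).
  move=> leij; case: (leqP (j - i) n) => len.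
    have : minn (j - i) k <= hamming (x i) (x j) by apply: spread; lia.
    by move: (hamming _ _) => h; lia.
  have : minn (i + n.*2 - j) k <= hamming (x j) (x (i + n.*2)).
    by apply: spread; lia.
  by rewrite x_per hammingC; move: (hamming _ _) => h; lia.
pose c := mkseq x n.*2; have c_size : size c = n.*2 by rewrite size_mkseq.
(* As [k > 0], distance zero forces an arc of length zero. *)
have c_uniq : uniq c.
  apply/mkseq_uniqP => i j; rewrite !inE => lti ltj.
  wlog leij : i j lti ltj / i <= j => [th E|E].
    by case: (leqP i j) => [|/ltnW] le; [|apply/esym]; apply: th.
  have := spread2 i j; rewrite E hammingxx; lia.
have cE i : cyc_nth (x 0) c i = x i.
  rewrite /cyc_nth c_size nth_mkseq; last by rewrite ltn_pmod; lia.
  rewrite [in RHS](divn_eq i n.*2) addnC; elim: (i %/ _) => [|q IHq].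
    by rewrite addn0.
  by rewrite mulSn addnCA addnC x_per.
have c_gt0 : 0 < size c by rewrite c_size; lia.
split; last first.
  rewrite (transitions_mkseq step x_per) => [i|]; last by lia.
  rewrite size_mkseq doubleK => lti; rewrite !onth_mkseq; try by lia.
  by rewrite addnC per.
split.
  rewrite /graph_cycle -/c c_uniq c_size andbT; apply/andP; split; first by lia.
  apply: cycle_from_next => // u /(cyc_nthP (x 0))[i _ ->].
  by rewrite next_cyc_nth // !cE cube_adjE (hamming_step wx).
have main i j : i <= j <= i + n.*2 ->
    minn (gdist (cycle_adj c) (x i) (x j)) k <= hamming (x i) (x j).
  move=> leij; have := spread2 i j leij.
  have : gdist (cycle_adj c) (x i) (x j) <= j - i.
    by rewrite -(cE i) -(cE j); apply: gdist_cycle_le => //; lia.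
  have : gdist (cycle_adj c) (x j) (x (i + n.*2)) <= i + n.*2 - j.
    by rewrite -(cE j) -(cE (i + n.*2)); apply: gdist_cycle_le => //; lia.
  rewrite x_per (gdist_sym _ _ (@cycle_adj_sym _ c)).
  by move: (gdist _ _ _) (hamming _ _) => g h; lia.
move=> u v /(cyc_nthP (x 0))[i lti ->] /(cyc_nthP (x 0))[j ltj ->].
rewrite gdist_cubeE !cE; move: lti ltj; rewrite !c_size => lti ltj.
case: (leqP i j) => le; first by apply: main; lia.
by rewrite hammingC gdist_sym; [apply: main; lia | apply: cycle_adj_sym].
Qed.

(** * Walks that flip [M] coordinates in cyclic order *)

Section CyclicWalk.
Variable M : nat.
Hypothesis M_gt0 : 0 < M.

(** The quotient counts the flips of [b]: the step from [t] flips the one [b < M] for which [M]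
    divides [t + b + 1]. *)
Definition cyclic_walk t b := odd ((t + b) %/ M).

(** Hermite's identity: raising [t] by one trades the term [t %/ M] for [(t + M) %/ M]. *)
Lemma hermite t : \sum_(b < M) (t + b) %/ M = t.
Proof.
elim: t => [|t IHt].
  by rewrite big1 // => b _; rewrite add0n divn_small.
have: \sum_(b < M.+1) (t + b) %/ M = t + (t %/ M + 1).
  by rewrite big_ord_recr /= IHt divnDr // divnn M_gt0.
rewrite big_ord_recl /= addn0.
under eq_bigr do rewrite /bump /= add1n addnS -addSn.
by move: (\sum_(b < M) _) => S; lia.
Qed.

Lemma cyclic_walk_antipode t b : cyclic_walk (t + M) b = ~~ cyclic_walk t b.
Proof. by rewrite /cyclic_walk addnAC divnDr // divnn M_gt0 addn1. Qed.

(** Within [M] steps each quotient grows by 0 or 1, so parity changes count the growth, which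
    [hermite] sums to [g]. *)
Lemma cyclic_walk_dist_short t g : g <= M ->
  \sum_(b < M) (cyclic_walk t b != cyclic_walk (t + g) b) = g.
Proof.
move=> le_g; apply/eqP; rewrite -(eqn_add2l t) -{1}(hermite t) -[eqbRHS]hermite.
rewrite -big_split; apply/eqP/eq_bigr => b _ /=; rewrite /cyclic_walk addnAC.
have := leq_div2r M (leq_addr g (t + b)).
have : (t + b + g) %/ M <= (t + b + M) %/ M by apply: leq_div2r; rewrite leq_add2l.
rewrite [_ %/ _ in leqRHS]divnDr // divnn M_gt0.
move: (_ %/ M) (_ %/ M) => q q' le1 le2.
have [->|->] : q' = q \/ q' = q.+1 by lia.
  by rewrite eqxx addn0.
by rewrite /=; case: (odd q); rewrite addn1.
Qed.

Lemma cyclic_walk_dist_long t g : M <= g <= M.*2 ->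
  \sum_(b < M) (cyclic_walk t b != cyclic_walk (t + g) b) = M.*2 - g.
Proof.
move=> leg; rewrite -[RHS](@cyclic_walk_dist_short (t + g)); last by lia.
apply: eq_bigr => b _; have -> : t + g + (M.*2 - g) = t + M + M by lia.
by rewrite !cyclic_walk_antipode negbK eq_sym.
Qed.

End CyclicWalk.

(** * The extremal code as two interleaved cyclic walks *)

Section ExtremalCode.
Variable m : nat.
Hypothesis m_gt0 : 0 < m.
Local Notation n := (4 * m + 3).
Local Notation d := (m.+1 + (2 * m).+1).

(** The transitions before [i] at even places of their half period, of which each half period has
    [2m + 2]. *)
Definition even_steps i := i %/ n * (m.+1).*2 + uphalf (i %% n).
Definition odd_steps i := i %/ n * (2 * m).+1 + (i %% n)./2.

Lemma even_odd_steps i : even_steps i + odd_steps i = i.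
Proof.
rewrite [RHS](divn_eq i n) /even_steps /odd_steps.
by move: (i %/ n) (i %% n) => q r; nia.
Qed.

Lemma even_steps_period i : even_steps (i + n) = even_steps i + (m.+1).*2.
Proof.
rewrite /even_steps divnDr // divnn modnDr addn3 /= mulnDl mul1n.
by rewrite addnAC.
Qed.

Lemma odd_steps_period i : odd_steps (i + n) = odd_steps i + (2 * m).+1.
Proof.
rewrite /odd_steps divnDr // divnn modnDr addn3 /= mulnDl mul1n.
by rewrite addnAC.
Qed.

(** Even and odd places alternate, except that two even places meet where half periods join; at most
    one such seam lies in a window of [n] steps, hence the excess 2. *)
Lemma steps_bounds i j : i <= j <= i + n ->
  [/\ even_steps i <= even_steps j <= even_steps i + (m.+1).*2,
      odd_steps i <= odd_steps j <= odd_steps i + (2 * m).+1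
    & even_steps j + odd_steps i <= odd_steps j + even_steps i + 2].
Proof.
move=> leij; have lt_i : i %% n < n by rewrite ltn_pmod // addn3.
have lt_j : j %% n < n by rewrite ltn_pmod // addn3.
have Ei := divn_eq i n; have Ej := divn_eq j n.
rewrite /even_steps /odd_steps.
move: (i %/ n) (i %% n) (j %/ n) (j %% n) lt_i lt_j Ei Ej => q r q' r' lt_r lt_r' Ei Ej.
have [Eq|Eq] : q' = q \/ q' = q.+1 by nia.
  by split; nia.
by split; nia.
Qed.

(** Over a half period the first walk makes a full turn and the second reaches its antipode, so the
    last [2m + 1] coordinates form [D]. *)
Definition extremal_vertex i : cube d := [ffun a => match split a with
  | inl b => cyclic_walk m.+1 (even_steps i) b
  | inr b => cyclic_walk (2 * m).+1 (odd_steps i) b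
  end].

Lemma hamming_extremal i j : hamming (extremal_vertex i) (extremal_vertex j) =
  \sum_(b < m.+1)
    (cyclic_walk m.+1 (even_steps i) b != cyclic_walk m.+1 (even_steps j) b)
  + \sum_(b < (2 * m).+1)
    (cyclic_walk (2 * m).+1 (odd_steps i) b != cyclic_walk (2 * m).+1 (odd_steps j) b).
Proof.
rewrite /hamming big_split_ord; congr (_ + _); apply: eq_bigr => b _; rewrite !ffunE.
  by rewrite (unsplitK (inl b)).
by rewrite (unsplitK (inr b)).
Qed.

(** Let the window have [e] even and [o] odd steps. The second walk contributes [o], the first [e]
    or, beyond [m + 1], [2m + 2 - e]; then [e <= o + 2] leaves at least [2m]. *)
Lemma extremal_spread i j : i <= j <= i + n ->
  minn (j - i) (2 * m) <= hamming (extremal_vertex i) (extremal_vertex j).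
Proof.
move=> leij; have [bE bO bEO] := steps_bounds leij.
have Ei := even_odd_steps i; have Ej := even_odd_steps j.
rewrite hamming_extremal.
rewrite -(@subnKC (even_steps i) (even_steps j)); last by lia.
rewrite -(@subnKC (odd_steps i) (odd_steps j)); last by lia.
rewrite [X in _ + X]cyclic_walk_dist_short //; last by lia.
case: (leqP (even_steps j - even_steps i) m.+1) => le.
  by rewrite cyclic_walk_dist_short //; lia.
by rewrite cyclic_walk_dist_long //; lia.
Qed.

Lemma extremal_adj i : cube_adj (extremal_vertex i) (extremal_vertex i.+1).
Proof.
have [bE bO _] := @steps_bounds i i.+1 ltac:(lia).
have Ei := even_odd_steps i; have Ej := even_odd_steps i.+1.
rewrite cube_adjE hamming_extremal.
rewrite -(@subnKC (even_steps i) (even_steps i.+1)); last by lia.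
rewrite -(@subnKC (odd_steps i) (odd_steps i.+1)); last by lia.
by rewrite !cyclic_walk_dist_short //; lia.
Qed.

Lemma extremal_code_exists :
  exists c : seq (cube d), symmetric_code (2 * m) c /\ size c = 8 * m + 6.
Proof.
have [tau step] := cube_walk_transitions (ord0 : 'I_d) extremal_adj.
(* Adding [n] fixes the first block of coordinates and complements the second, so the same
   coordinate changes. *)
have per i : tau (i + n) = tau i.
  apply/esym/eqP.
  have E a : (a == tau (i + n)) = (a == tau i).
    have diff l : (a == tau l) = (extremal_vertex l a != extremal_vertex l.+1 a).
      by rewrite step; case: (extremal_vertex l a); case: (a == _).
    rewrite !diff -addSn !ffunE; case: (split a) => b.
      by rewrite !even_steps_period -addnn !addnA !cyclic_walk_antipode // !negbK.
    by rewrite !odd_steps_period !cyclic_walk_antipode // (inj_eq negb_inj).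
  by rewrite E.
exists (mkseq extremal_vertex n.*2); split; last by rewrite size_mkseq; lia.
apply: (@symmetric_walk_code _ _ _ _ tau); [lia | lia |].
split=> // i j; exact: extremal_spread.
Qed.

End ExtremalCode.

(** * Length bound and uniqueness for codes *)

Lemma symmetric_code_size m d (c : seq (cube d)) :
  1 < m -> d = 3 * m + 2 -> symmetric_code (2 * m) c -> size c <= 8 * m + 6.
Proof.
move=> m_gt1 dE; have d_gt0 : 0 < d by lia.
case/(symmetric_code_walk (Ordinal d_gt0)) => x [tau [c_even wx _ _]].
have := symmetric_walk_length m_gt1 dE wx.
by move: c_even; move: (size c) => N; lia.
Qed.

Lemma symmetric_code_unique m d (c c' : seq (cube d)) :
  0 < m -> d = 3 * m + 2 ->
  symmetric_code (2 * m) c -> size c = 8 * m + 6 ->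
  symmetric_code (2 * m) c' -> size c' = 8 * m + 6 -> isomorphic_codes c c'.
Proof.
move=> m_gt0 dE; have d_gt0 : 0 < d by lia.
have n_half : (8 * m + 6)./2 = 4 * m + 3 by lia.
case/(symmetric_code_walk (Ordinal d_gt0)) => x [tau [_ wx Ec tau_per]] sz.
case/(symmetric_code_walk (Ordinal d_gt0)) => x' [tau' [_ wx' Ec' _]] sz'.
rewrite sz sz' n_half in wx wx' Ec Ec' tau_per.
have [r [sigma E]] := extremal_walk_unique m_gt0 dE wx wx'.
have r_lt : r %% (8 * m + 6) < 8 * m + 6 by rewrite ltn_pmod // addnS.
(* Beyond the length [rot] does not wrap around, so [r] is reduced first. *)
exists (r %% (8 * m + 6)), sigma; rewrite Ec Ec' rot_mkseq //; last exact: ltnW.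
rewrite /mkseq -map_comp; apply: eq_map => i /=; rewrite E; congr (sigma _).
rewrite {1}(divn_eq r (8 * m + 6)) -addnA; elim: (r %/ _) => // q IHq.
by rewrite mulSn -addnA addnC tau_per.
Qed.

Theorem lemma4 (k d : nat) (hk : ~~ odd k) (hk4 : 4 <= k)
    (hd : d = (3 * k + 4)./2) :
  [/\ exists c : seq (cube d), symmetric_code k c /\ size c = 4 * k + 6,
      forall c : seq (cube d), symmetric_code k c -> size c <= 4 * k + 6
    & forall c c' : seq (cube d),
        symmetric_code k c -> size c = 4 * k + 6 ->
        symmetric_code k c' -> size c' = 4 * k + 6 ->
        isomorphic_codes c c'].
Proof.
have [m kE] : exists m, k = 2 * m by exists k./2; lia.
rewrite {}kE in hk hk4 hd *; have m_gt1 : 1 < m by lia.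
have dE : d = 3 * m + 2 by lia.
have -> : 4 * (2 * m) + 6 = 8 * m + 6 by lia.
split=> [|c|c c'].
- have -> : d = m.+1 + (2 * m).+1 by lia.
  by apply: extremal_code_exists; lia.
- exact: symmetric_code_size.
- by apply: symmetric_code_unique; lia.
Qed.
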